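(* There are absolute constants $c,T_0>0$ such that for every $T\ge T_0$ and every randomized player algorithm in the hidden bandit model with parameter $p=\frac12$ and $T$ rounds, there is an oblivious sequence of rewards $r_t(0),r_t(1)\in[0,1]$, $t=1,\dots,T$ (fixed in advance on both arms), for which the expected regret of the player with respect to the reference arm is at least $c\,T/\log^{3/2}T$.
   Context: Hidden bandit model with parameters $T$ (number of rounds) and $p\in(0,1)$. There are two arms: arm $0$ (the reference arm) and arm $1$ (the decoy arm). Before round 1 the player is placed at random on arm $0$ with probability $\frac{p}{1+p}$ and on arm $1$ with probability $\frac1{1+p}$. On each round the player chooses one of two actions: ''stay'', which keeps him on the arm on which he entered the round; or ''switch'', which moves him to arm $1$ if he entered the round on arm $0$, and if he entered on arm $1$ moves him to arm $0$ with probability $p$ and leaves him on arm $1$ with probability $1-p$. Let $X_t\in\{0,1\}$ be the arm pulled on round $t$ (the arm the player is on after the action of round $t$). The player does not observe $X_t$; on round $t$ he observes only the reward $r_t(X_t)$. A player algorithm chooses (possibly at random) each action on the basis of his past actions and observed rewards. The expected regret is $$\mathrm{Regret}_T=\sum_{t=1}^T r_t(0)-\mathbf E\Big[\sum_{t=1}^T r_t(X_t)\Big].$$ *)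

(* Defs.v *)
From mathcomp Require Import all_boot all_order all_algebra.
From mathcomp Require Import reals exp.

Set Implicit Arguments.
Unset Strict Implicit.
Unset Printing Implicit Defensive.

Import Order.TTheory GRing.Theory Num.Theory.
Local Open Scope ring_scope.

Notation arm := bool (only parsing).
Definition ref_arm : arm := false.
Definition decoy_arm : arm := true.

Notation action := bool (only parsing).
Definition stay : action := false.
Definition switch : action := true.

Definition init_prob (R : realType) (p : R) (x : arm) : R :=
  if x == ref_arm then p / (1 + p) else 1 / (1 + p).

(* Probability that a round entered on arm [x], on which the action is [a], is
   played on arm [y]. *)
Definition move_prob (R : realType) (p : R) (x : arm) (a : action) (y : arm)
    : R :=
  if a == stay then (y == x)%:R
  else if x == ref_arm then (y == decoy_arm)%:R
  else if y == ref_arm then p else 1 - p.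

(* What the player knows before a round: the past actions and observed rewards,
   oldest first. The length of a history is the number of past rounds, so a
   player algorithm may depend on the round. *)
Definition history (R : realType) := seq (action * R).

(* A randomized algorithm gives, for each history, the conditional probability
   of choosing [switch] on the next round. *)
Record player (R : realType) := Player {
  switch_prob : history R -> R;
  switch_prob_ge0 : forall h, 0 <= switch_prob h;
  switch_prob_le1 : forall h, switch_prob h <= 1 }.

Definition action_prob (R : realType) (A : player R) (h : history R)
    (a : action) : R :=
  if a == switch then switch_prob A h else 1 - switch_prob A h.

(* Rounds are numbered from 0: the index [t : 'I_T] is the (t+1)-st round. *)
Definition rewards (R : realType) (T : nat) := 'I_T -> arm -> R.

(* The arms [X_0, X_1, ..., X_T], where [X_0] is the initial arm and [X_s] is
   the arm pulled on the s-th round (counted from 1), and the T actions. *)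
Definition trajectory (T : nat) :=
  ({ffun 'I_T.+1 -> arm} * {ffun 'I_T -> action})%type.

Definition entered (T : nat) (w : trajectory T) (t : 'I_T) : arm :=
  w.1 (widen_ord (leqnSn T) t).

Definition pulled (T : nat) (w : trajectory T) (t : 'I_T) : arm :=
  w.1 (lift ord0 t).

Definition history_before (R : realType) (T : nat) (r : rewards R T)
    (w : trajectory T) (t : 'I_T) : history R :=
  [seq (w.2 s, r s (pulled w s)) | s : 'I_T <- enum 'I_T & (s < t)%N].

(* Law of the trajectory: initial placement, then on each round the player's
   choice followed by the move. *)
Definition traj_prob (R : realType) (p : R) (T : nat) (A : player R)
    (r : rewards R T) (w : trajectory T) : R :=
  init_prob p (w.1 ord0) *
  \prod_(t < T) (action_prob A (history_before r w t) (w.2 t) *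
                 move_prob p (entered w t) (w.2 t) (pulled w t)).

Definition expected_reward (R : realType) (p : R) (T : nat) (A : player R)
    (r : rewards R T) : R :=
  \sum_(w : trajectory T) traj_prob p A r w * \sum_(t < T) r t (pulled w t).

Definition regret (R : realType) (p : R) (T : nat) (A : player R)
    (r : rewards R T) : R :=
  \sum_(t < T) r t ref_arm - expected_reward p A r.

(* Main.v *)
Require Import Defs.
From mathcomp Require Import all_boot all_order all_algebra.
From mathcomp Require Import reals exp.
From mathcomp Require Import ring lra zify.
Import Order.TTheory GRing.Theory Num.Theory.
Local Open Scope ring_scope.

(* The rewards are phi(W_t + [x = ref]), where W_t is the sum of independent
   two-sided geometric noises attached to the L ~ log T dyadic blocks containing t
   (the tree mechanism of differential privacy), taken on a cycle so that shifting
   the noise is a bijection, and phi is a tent function of slope 1/(2h).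
   Raising W by one from round s on only changes the noise of at most L blocks,
   hence changes probabilities by a factor at most lam^-L <= 2 if
   lam = 1 - 1/(2L). On the other hand, when the player last switched on round s,
   he is at least as likely to be since then on the decoy arm as on the reference
   arm, and these two situations differ, for his observations, by exactly such a
   shift. So he pulls the decoy arm with probability at least 1/3 on every round,
   whatever he has observed. The second moment of W_t is O(L^3), so that with h of
   order L^(3/2) the walk mostly stays on the increasing side of phi, where the
   reference arm is better by 1/(2h). *)

(** * Norm on a cycle of odd length *)

(* Distance to 0 on the cycle Z/(2n+1); its maximal value is n. *)
Definition cyc_norm {n : nat} (x : 'I_(n.*2).+1) : nat :=
  minn x ((n.*2).+1 - x).

Lemma val_cycD n (x y : 'I_(n.*2).+1) :
  (x + y)%R = (if x + y < (n.*2).+1 then x + y else x + y - (n.*2).+1)%N :> nat.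
Proof.
have := ltn_ord x; have := ltn_ord y => hy hx /=.
case: ltnP => h; first by rewrite modn_small.
rewrite -{1}(subnK h) modnDr modn_small //; lia.
Qed.

Lemma val_cycN n (x : 'I_(n.*2).+1) :
  (- x)%R = (if (x == 0 :> nat)%N then 0 else (n.*2).+1 - x)%N :> nat.
Proof.
have := ltn_ord x => hx /=.
case: eqP => [->|/eqP x0]; first by rewrite subn0 modnn.
by rewrite modn_small //; lia.
Qed.

Lemma cyc_normN n (x : 'I_(n.*2).+1) : cyc_norm (- x) = cyc_norm x.
Proof.
rewrite /cyc_norm val_cycN; have := ltn_ord x; case: eqP => [->|] hx; lia.
Qed.

Lemma cyc_norm_le n (x : 'I_(n.*2).+1) : (cyc_norm x <= n)%N.
Proof. rewrite /cyc_norm; have := ltn_ord x; lia. Qed.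

(** Up to sign [x] and [y] are [a] and [b], so their sum and difference are, in some order and up to
    sign, [a + b] and [a - b]; the norm is at most the size of any representative. *)
Lemma cyc_norm_parallelogram n (x y : 'I_(n.*2).+1) :
  (cyc_norm (x + y)%R ^ 2 + cyc_norm (x - y)%R ^ 2 <=
   (cyc_norm x ^ 2).*2 + (cyc_norm y ^ 2).*2)%N.
Proof.
have := ltn_ord x; have := ltn_ord y => hy hx.
pose a := cyc_norm x; pose b := cyc_norm y.
(* With truncated subtraction, [(a - b) + (b - a)] is the absolute difference. The first alternative
   is for [x] and [y] on the same half of the cycle. *)
suff H : (cyc_norm (x + y)%R <= a + b)%N /\
         (cyc_norm (x - y)%R <= (a - b) + (b - a))%N \/
         (cyc_norm (x - y)%R <= a + b)%N /\
         (cyc_norm (x + y)%R <= (a - b) + (b - a))%N.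
  rewrite -/a -/b; have: ((a + b) ^ 2 + ((a - b) + (b - a)) ^ 2 =
    (a ^ 2).*2 + (b ^ 2).*2)%N.
    case/orP: (leq_total a b) => /subnKC <-;
      rewrite addKn subnDA subnn sub0n; nia.
  by case: H => -[h1 h2] <-; [|rewrite addnC];
    apply: leq_add; rewrite leq_exp2r.
have ea : a = if (x <= n)%N then x : nat else ((n.*2).+1 - x)%N.
  by rewrite /a /cyc_norm; case: leqP; lia.
have eb : b = if (y <= n)%N then y : nat else ((n.*2).+1 - y)%N.
  by rewrite /b /cyc_norm; case: leqP; lia.
have l1 (z : 'I_(n.*2).+1) : (cyc_norm z <= z)%N by rewrite /cyc_norm geq_minl.
have l2 (z : 'I_(n.*2).+1) : (cyc_norm z <= (n.*2).+1 - z)%N.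
  by rewrite /cyc_norm geq_minr.
have := l2 (x - y); have := l1 (x - y); have := l2 (x + y); have := l1 (x + y).
move: (cyc_norm (x + y)) (cyc_norm (x - y)) => c d.
rewrite !val_cycD val_cycN {l1 l2}; clearbody a b.
case: eqP => y0.
  by case: (leqP x n) ea => xs ->; move: eb; rewrite y0 !addn0 ltn_ord leq0n => ->; lia.
by case: (leqP x n) ea => xs ->; case: (leqP y n) eb => ys -> {a b};
  case: (ltnP (x + y)); case: (ltnP (x + (_ - y))); lia.
Qed.

Lemma cyc_norm_succ n (x : 'I_(n.*2).+1) : (0 < n)%N ->
  (cyc_norm (x + inord 1)%R <= (cyc_norm x).+1)%N /\
  (cyc_norm x <= (cyc_norm (x + inord 1))%R.+1)%N.
Proof.
move=> n0; rewrite /cyc_norm val_cycD inordK; last lia.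
have hx := ltn_ord x; case: (ltnP (x + 1)); lia.
Qed.

(** The cycle has length [4h + 1]. As [x] is represented between [1 - h] and [h - 1], both arguments
    are represented between 1 and [2h], where the norm is the identity. *)
Lemma cyc_norm_ramp h (x : 'I_(h.*2.*2).+1) : (cyc_norm x < h)%N ->
  cyc_norm (x + inord 1 + inord h)%R = (cyc_norm (x + inord h))%R.+1.
Proof.
rewrite /cyc_norm => hx; have x_lt := ltn_ord x.
rewrite !val_cycD !inordK; [|lia..].
have [x_small|x_large] := leqP x h.*2.
  have -> : (x + 1 < h.*2.*2.+1)%N by lia.
  have -> : (x + 1 + h < h.*2.*2.+1)%N by lia.
  have -> : (x + h < h.*2.*2.+1)%N by lia.
  lia.
have -> : (x + h < h.*2.*2.+1)%N = false by lia.
case: (ltnP (x + 1) h.*2.*2.+1) => hx1.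
  case: (ltnP (x + 1 + h) h.*2.*2.+1) => ?; lia.
case: (ltnP (x + 1 - h.*2.*2.+1 + h) h.*2.*2.+1) => ?; lia.
Qed.

Lemma cyc_norm_sum (V : nmodType) n (F : nat -> V) :
  \sum_(x : 'I_(n.*2).+1) F (cyc_norm x) =
  \sum_(k < n.+1) F k + \sum_(k < n) F k.+1.
Proof.
rewrite -(big_mkord xpredT (fun i => F (minn i ((n.*2).+1 - i)))).
rewrite (@big_cat_nat _ _ _ n.+1) //=; last lia.
congr (_ + _).
  rewrite big_mkord; apply: eq_bigr => i _; congr F; have := ltn_ord i; lia.
rewrite big_nat_rev -{1}[n.+1]add0n big_addn.
have -> : ((n.*2).+1 - n.+1 = n)%N by lia.
by rewrite big_mkord; apply: eq_bigr => i _; congr F; have := ltn_ord i; lia.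
Qed.

(** * Dyadic blocks and shifts of the noise *)

(* One independent element of a cycle per dyadic block: the index [(k, j)] stands
   for the rounds [t] with [j * 2 ^ k <= t.+1 < j.+1 * 2 ^ k]. *)
Definition noise (L T n : nat) := {ffun 'I_L * 'I_T.+1 -> 'I_(n.*2).+1}.

Definition block {T : nat} (t : 'I_T) (k : nat) : 'I_T.+1 :=
  inord (t.+1 %/ 2 ^ k).

Definition walk {L T n : nat} (xi : noise L T n) (t : 'I_T) : 'I_(n.*2).+1 :=
  \sum_(k < L) xi (k, block t k).

(* The maximal dyadic blocks contained in [s, +oo): the block starts at or after
   [s], but its parent does not. *)
Definition dyadic_cover {L T : nat} (s : nat) (v : 'I_L * 'I_T.+1) : bool :=
  (s <= v.2 * 2 ^ v.1)%N && (v.2./2 * 2 ^ v.1.+1 < s)%N.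

Definition shift {L T n : nat} (s : nat) (xi : noise L T n) : noise L T n :=
  [ffun v => xi v + inord 1 *+ dyadic_cover s v].

Lemma val_block T (t : 'I_T) k : block t k = (t.+1 %/ 2 ^ k)%N :> nat.
Proof.
by rewrite inordK // ltnS (leq_trans (leq_div _ _)).
Qed.

(** Going up the levels, the starts of the blocks containing [t.+1] decrease from [t.+1] to 0: they
    pass below [s] exactly once if [s <= t.+1], and are below it from the outset otherwise. *)
Lemma sum_dyadic_cover L T (s : nat) (t : 'I_T) : (0 < s)%N -> (T < 2 ^ L)%N ->
  (\sum_(k < L) dyadic_cover s (k, block t k) = (s <= t.+1))%N.
Proof.
move=> s_gt0 T_lt.
have H m : (\sum_(k < m) ((s <= t.+1 %/ 2 ^ k * 2 ^ k) &&
     (t.+1 %/ 2 ^ k.+1 * 2 ^ k.+1 < s)) +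
    (s <= t.+1 %/ 2 ^ m * 2 ^ m) = (s <= t.+1))%N.
  elim: m => [|m IHm]; first by rewrite big_ord0 expn0 divn1 muln1.
  rewrite big_ord_recr /= -[RHS]IHm -addnA; congr (_ + _)%N.
  have : (t.+1 %/ 2 ^ m.+1 * 2 ^ m.+1 <= t.+1 %/ 2 ^ m * 2 ^ m)%N.
    rewrite expnS mulnC -mulnA [X in (_ <= X)%N]mulnC mulnCA leq_mul2l.
    by rewrite [(2 * 2 ^ m)%N]mulnC divnMA [(2 * _)%N]mulnC leq_trunc_div orbT.
  by case: leqP; case: leqP; lia.
rewrite -[RHS](H L) divn_small ?(leq_trans _ T_lt) ?ltnS //.
rewrite mul0n leqn0 (gtn_eqF s_gt0) addn0; apply: eq_bigr => k _.
by rewrite /dyadic_cover /= !val_block -divn2 -divnMA -expnSr.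
Qed.

Lemma walk_shift L T n s (xi : noise L T n) t : (0 < s)%N -> (T < 2 ^ L)%N ->
  walk (shift s xi) t = walk xi t + inord 1 *+ (s <= t.+1)%N.
Proof.
move=> s_gt0 T_lt; rewrite -(@sum_dyadic_cover L) // -sumrMnr -big_split /=.
by apply: eq_bigr => k _; rewrite ffunE.
Qed.

Lemma shift_inj L T n s : injective (@shift L T n s).
Proof.
move=> xi1 xi2 /ffunP e; apply/ffunP => v; have := e v.
by rewrite !ffunE => /addIr.
Qed.

(** Each level contributes at most one block: if two blocks of a level start at or after [s], so
    does the parent of the later one. *)
Lemma card_dyadic_cover L T s : (#|@dyadic_cover L T s| <= L)%N.
Proof.
rewrite -[X in (_ <= X)%N]card_ord.
rewrite -(card_in_imset (f := @fst _ _)) ?max_card // => -[k i] [k' j] /=.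
have main (k0 : 'I_L) (i0 j0 : 'I_T.+1) : (i0 < j0)%N ->
    dyadic_cover s (k0, i0) -> dyadic_cover s (k0, j0) -> False.
  move=> lt_ij /andP[/= h1 h2] /andP[/= h3 h4].
  have := leq_trans h4 h1; rewrite expnS mulnA ltn_pmul2r ?expn_gt0 //.
  have := leq_trans h2 h1; rewrite expnS mulnA ltn_pmul2r ?expn_gt0 //.
  lia.
rewrite !unfold_in => ci cj ekk; rewrite -ekk in cj *; congr (_, _).
apply/val_inj => /=; case: (ltngtP i j) => // lt_ij.
  by case: (main k i j).
by case: (main k j i).
Qed.

(** * Weights of the noise and second moments *)

Section Weight.
Variables (R : realType) (lam : R).
Hypotheses (lam_gt0 : 0 < lam) (lam_le1 : lam <= 1).

(* Truncated two-sided geometric noise, not normalized. *)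
Definition weight {L T n : nat} (xi : noise L T n) : R :=
  \prod_v lam ^+ cyc_norm (xi v).

Lemma weight_gt0 L T n (xi : noise L T n) : 0 < weight xi.
Proof. by apply: prodr_gt0 => v _; rewrite exprn_gt0. Qed.

(** Only the at most [L] coordinates in the cover move, and each of their norms grows by at most
    one. *)
Lemma weight_shift L T n s (xi : noise L T n) : (0 < n)%N ->
  lam ^+ L * weight xi <= weight (shift s xi).
Proof.
move=> n_gt0.
apply: (@le_trans _ _ (\prod_v ((if dyadic_cover s v then lam else 1) *
                       lam ^+ cyc_norm (xi v)))).
  rewrite big_split /= ler_wpM2r //; first exact/ltW/weight_gt0.
  rewrite -big_mkcond prodr_const ler_wiXn2l ?card_dyadic_cover //; exact: ltW.
apply: ler_prod => v _; rewrite ffunE; case: dyadic_cover.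
  rewrite mulr1n -exprS exprn_ge0 ?ler_wiXn2l ?(ltW lam_gt0) //.
  by case: (@cyc_norm_succ n (xi v) n_gt0).
by rewrite mulr0n addr0 mul1r lexx exprn_ge0 // ltW.
Qed.

Definition cyc_mass n : R := \sum_(x : 'I_(n.*2).+1) lam ^+ cyc_norm x.

(** Two summations by parts reduce the second moment to the first and the first to the mass; the
    boundary terms are nonpositive and are dropped. *)
Lemma geometric_second_moment m :
  (1 - lam) ^+ 2 * \sum_(k < m) k%:R ^+ 2 * lam ^+ k <=
  2 * \sum_(k < m) lam ^+ k.
Proof.
have E1 : (1 - lam) * \sum_(k < m) k%:R * lam ^+ k <= lam * \sum_(k < m) lam ^+ k.
  suff -> : (1 - lam) * \sum_(k < m) k%:R * lam ^+ k =
      lam * \sum_(k < m) lam ^+ k - m%:R * lam ^+ m.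
    by rewrite gerBl mulr_ge0 // exprn_ge0 // ltW.
  elim: m => [|m IHm]; first by rewrite !big_ord0; ring.
  rewrite !big_ord_recr /= mulrDr IHm [lam ^+ m.+1]exprS -[m.+1%:R]natr1; ring.
have E2 : (1 - lam) * \sum_(k < m) k%:R ^+ 2 * lam ^+ k <=
    lam * (2 * \sum_(k < m) k%:R * lam ^+ k + \sum_(k < m) lam ^+ k).
  suff -> : (1 - lam) * \sum_(k < m) k%:R ^+ 2 * lam ^+ k =
    lam * (2 * \sum_(k < m) k%:R * lam ^+ k + \sum_(k < m) lam ^+ k) -
      m%:R ^+ 2 * lam ^+ m.
    by rewrite gerBl mulr_ge0 ?exprn_ge0 // ltW.
  elim: m {E1} => [|m IHm]; first by rewrite !big_ord0; ring.
  rewrite !big_ord_recr /= mulrDr IHm [lam ^+ m.+1]exprS -[m.+1%:R]natr1; ring.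
have S0 : 0 <= \sum_(k < m) lam ^+ k.
  by apply: sumr_ge0 => k _; rewrite exprn_ge0 // ltW.
move: E1 E2 S0; set s0 := \sum_(k < m) lam ^+ k.
set s1 := \sum_(k < m) k%:R * lam ^+ k.
set s2 := \sum_(k < m) k%:R ^+ 2 * lam ^+ k => E1 E2 S0.
rewrite expr2 -mulrA.
apply: (@le_trans _ _ ((1 - lam) * (lam * (2 * s1 + s0)))).
  by rewrite ler_wpM2l // subr_ge0.
have -> : (1 - lam) * (lam * (2 * s1 + s0)) =
  lam * (2 * ((1 - lam) * s1) + (1 - lam) * s0) by ring.
apply: (@le_trans _ _ (lam * (2 * (lam * s0) + (1 - lam) * s0))).
  by rewrite ler_wpM2l ?(ltW lam_gt0) // lerD2r ler_wpM2l.
have -> : lam * (2 * (lam * s0) + (1 - lam) * s0) = (lam + lam * lam) * s0 by ring.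
rewrite ler_wpM2r //; have : lam * lam <= 1 by rewrite mulr_ile1 // ltW.
by have := lam_le1; lra.
Qed.

Lemma cyc_second_moment n :
  (1 - lam) ^+ 2 * (\sum_(x : 'I_(n.*2).+1) (cyc_norm x)%:R ^+ 2 * lam ^+ cyc_norm x)
  <= 4 * cyc_mass n.
Proof.
rewrite (cyc_norm_sum R n (fun k => k%:R ^+ 2 * lam ^+ k)).
rewrite /cyc_mass (cyc_norm_sum R n (fun k => lam ^+ k)).
have := geometric_second_moment n.+1; rewrite [X in X <= _]/=.
(* The term of 0 vanishes, so both halves of the cycle have the same second moment. *)
have S2 : \sum_(k < n.+1) (k%:R ^+ 2 * lam ^+ k) =
          \sum_(k < n) (k.+1%:R ^+ 2 * lam ^+ k.+1).
  by rewrite big_ord_recl /= expr0n mul0r add0r.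
have P : 0 <= \sum_(k < n) lam ^+ k.+1.
  by apply: sumr_ge0 => k _; rewrite exprn_ge0 // ltW.
rewrite -S2 mulrDr; move: P; lra.
Qed.

(** Both sums factor over the coordinates and differ only in the factor of [v], which is the case of
    a single cycle. *)
Lemma noise_second_moment L T n (v : 'I_L * 'I_T.+1) :
  (1 - lam) ^+ 2 *
    (\sum_(xi : noise L T n) weight xi * (cyc_norm (xi v))%:R ^+ 2) <=
  4 * \sum_(xi : noise L T n) weight xi.
Proof.
pose F (w : 'I_L * 'I_T.+1) (x : 'I_(n.*2).+1) : R :=
  (if w == v then (cyc_norm x)%:R ^+ 2 else 1) * lam ^+ cyc_norm x.
have -> : \sum_(xi : noise L T n) weight xi * (cyc_norm (xi v))%:R ^+ 2 =
    \sum_(xi : noise L T n) \prod_w F w (xi w).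
  apply: eq_bigr => xi _; rewrite big_split /= mulrC; congr (_ * _).
  by rewrite -big_mkcond big_pred1_eq.
rewrite -(bigA_distr_bigA F) -(bigA_distr_bigA (fun _ x => lam ^+ cyc_norm x)) /=.
rewrite (bigD1 v) //= [X in _ <= 4 * X](bigD1 v) //= !mulrA.
have -> : \prod_(w | w != v) \sum_x F w x =
    \prod_(w : 'I_L * 'I_T.+1 | w != v) \sum_(x : 'I_(n.*2).+1) lam ^+ cyc_norm x.
  apply: eq_bigr => w /negbTE wv; apply: eq_bigr => x _.
  by rewrite /F wv mul1r.
rewrite ler_wpM2r //.
  by apply: prodr_ge0 => w _; apply: sumr_ge0 => x _; rewrite exprn_ge0 // ltW.
by rewrite /F eqxx; exact: cyc_second_moment.
Qed.

Definition negate_at {L T n} (v : 'I_L * 'I_T.+1) (xi : noise L T n)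
    : noise L T n := [ffun w => if w == v then - xi w else xi w].

Lemma negate_atK L T n v : involutive (@negate_at L T n v).
Proof.
move=> xi; apply/ffunP => w; rewrite !ffunE; case: eqP => // _.
by rewrite opprK.
Qed.

Lemma weight_negate_at L T n v (xi : noise L T n) :
  weight (negate_at v xi) = weight xi.
Proof.
apply: eq_bigr => w _; rewrite ffunE; case: eqP => // _.
by rewrite cyc_normN.
Qed.

(* The law of each coordinate is symmetric, so the parallelogram inequality plays
   the role of independence and centering. *)
Lemma sum_noise_second_moment L T n (s : seq ('I_L * 'I_T.+1)) : uniq s ->
  (1 - lam) ^+ 2 * (\sum_(xi : noise L T n) weight xi *
     (cyc_norm (\sum_(v <- s) xi v))%:R ^+ 2) <=
  4 * (size s)%:R * \sum_(xi : noise L T n) weight xi.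
Proof.
elim: s => [_|v s IHs /= /andP[vs us]].
  rewrite big1 ?mulr0 ?mul0r // => xi _.
  by rewrite big_nil /cyc_norm /= min0n expr0n mulr0.
have sum_neg (xi : noise L T n) :
    \sum_(w <- v :: s) negate_at v xi w = \sum_(w <- s) xi w - xi v.
  rewrite big_cons ffunE eqxx addrC; congr (_ - _).
  apply: eq_big_seq => w ws; rewrite ffunE; case: eqP => // wv.
  by rewrite -wv ws in vs.
apply: (@le_trans _ _ ((1 - lam) ^+ 2 *
   (\sum_(xi : noise L T n) weight xi * (cyc_norm (\sum_(w <- s) xi w))%:R ^+ 2 +
    \sum_(xi : noise L T n) weight xi * (cyc_norm (xi v))%:R ^+ 2))); last first.
  have := IHs us; have := noise_second_moment L T n v.
  rewrite mulrDr -[(size s).+1%:R]natr1; lra.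
rewrite ler_wpM2l ?sqr_ge0 //.
set A := \sum_(xi : noise L T n) _.
(* Negating coordinate [v] preserves weights and turns the sum into a difference, so [A + A] fits
   the parallelogram inequality. *)
have A2 : A = \sum_(xi : noise L T n) weight xi *
     (cyc_norm (\sum_(w <- s) xi w - xi v))%:R ^+ 2.
  rewrite /A (reindex_inj (inv_inj (@negate_atK L T n v))).
  by apply: eq_bigr => xi _; rewrite weight_negate_at sum_neg.
suff : A + A <= 2 * (\sum_(xi : noise L T n) weight xi *
     (cyc_norm (\sum_(w <- s) xi w))%:R ^+ 2 +
    \sum_(xi : noise L T n) weight xi * (cyc_norm (xi v))%:R ^+ 2) by lra.
rewrite {2}A2 -!big_split /= mulr_sumr; apply: ler_sum => xi _.
rewrite -!mulrDr mulrCA ler_wpM2l ?(ltW (weight_gt0 _ _ _ _)) //.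
rewrite big_cons addrC [xi v + _]addrC [X in X <= _]addrC.
rewrite -!natrX -!natrD -natrM ler_nat mul2n doubleD.
exact: cyc_norm_parallelogram.
Qed.

Lemma walk_second_moment L T n (t : 'I_T) :
  (1 - lam) ^+ 2 * (\sum_(xi : noise L T n) weight xi *
     (cyc_norm (walk xi t))%:R ^+ 2) <=
  4 * L%:R * \sum_(xi : noise L T n) weight xi.
Proof.
pose s := [seq (k, block t k) | k : 'I_L <- enum 'I_L].
have us : uniq s by rewrite map_inj_uniq ?enum_uniq // => i j [].
have := @sum_noise_second_moment L T n s us.
rewrite size_map size_enum_ord.
under eq_bigr => xi _ do rewrite big_map big_enum /=.
exact.
Qed.

End Weight.

Arguments weight {R} lam {L T n} xi.

(** * Law of the trajectory and its marginals *)

Section Law.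
Variables (R : realType) (A : player R) (T : nat).
Implicit Types (r : rewards R T) (w : trajectory T) (t : 'I_T).

Definition round_prob (p : R) r w t : R :=
  action_prob A (history_before r w t) (w.2 t) *
  move_prob p (entered w t) (w.2 t) (pulled w t).

(* From round [m] on, the action and the next arm are uniform on their four
   values: this expresses the law of a prefix on full trajectories. *)
Definition partial_prob (p : R) r (m : nat) w : R :=
  init_prob p (w.1 ord0) *
  \prod_(t < T) (if (t < m)%N then round_prob p r w t else 4^-1).

Lemma eq_history r r' w w' t :
  (forall s : 'I_T, (s < t)%N -> w.2 s = w'.2 s) ->
  (forall s : 'I_T, (s < t)%N -> r s (pulled w s) = r' s (pulled w' s)) ->
  history_before r w t = history_before r' w' t.
Proof.
move=> eq_act eq_rew; apply/eq_in_map => s; rewrite mem_filter => /andP[st _].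
by rewrite eq_act ?eq_rew.
Qed.

(** The four choices of [b] and [y] run through all outcomes of round [t], and each is a bijection
    of trajectories. *)
Definition toggle t (b y : bool) w : trajectory T :=
  ([ffun i => w.1 i (+) (y && (i == lift ord0 t))],
   [ffun i => w.2 i (+) (b && (i == t))]).

Lemma toggleK t b y : involutive (toggle t b y).
Proof. by case=> x a; congr (_, _); apply/ffunP => i; rewrite !ffunE addbK. Qed.

Lemma toggle_action t b y w (s : 'I_T) : (s < t)%N ->
  (toggle t b y w).2 s = w.2 s.
Proof. by move=> st; rewrite ffunE -val_eqE (ltn_eqF st) andbF addbF. Qed.

Lemma toggle_arm t b y w (i : 'I_T.+1) : (i <= t)%N ->
  (toggle t b y w).1 i = w.1 i.
Proof.
move=> it; rewrite ffunE -val_eqE [val (lift _ _)]lift0 ltn_eqF ?andbF ?addbF //.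
Qed.

Lemma pulled_toggle t b y w (s : 'I_T) : (s < t)%N ->
  pulled (toggle t b y w) s = pulled w s.
Proof. by move=> st; rewrite /pulled toggle_arm // lift0. Qed.

Lemma history_toggle r t b y w (s : 'I_T) : (s <= t)%N ->
  history_before r (toggle t b y w) s = history_before r w s.
Proof.
by move=> st; apply: eq_history => u us;
  rewrite ?toggle_action ?pulled_toggle ?(leq_trans us).
Qed.

Lemma sum_round_prob_toggle p r t w :
  \sum_(b : bool) \sum_(y : bool) round_prob p r (toggle t b y w) t = 1.
Proof.
rewrite !big_bool /= /round_prob !history_toggle // /entered !toggle_arm //.
rewrite /pulled !ffunE !eqxx !andbT /=.
move: (history_before r w t) (w.1 (widen_ord _ t)) (w.2 t) (w.1 (lift ord0 t)).
move=> hist x a y; rewrite /action_prob /move_prob.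
by case: x; case: a; case: y => /=; ring.
Qed.

Lemma partial_prob_toggle p r t b y w :
  partial_prob p r t (toggle t b y w) = partial_prob p r t w.
Proof.
rewrite /partial_prob toggle_arm //; congr (_ * _); apply: eq_bigr => s _.
case: ltnP => // st.
by rewrite /round_prob history_toggle ?toggle_action ?pulled_toggle //
  ?(ltnW st) // /entered toggle_arm //= ltnW.
Qed.

Lemma partial_probS p r t w :
  partial_prob p r t.+1 w = 4 * partial_prob p r t w * round_prob p r w t.
Proof.
rewrite /partial_prob (bigD1 t) //= ltnSn [in RHS](bigD1 t) //= ltnn.
have -> : \prod_(i < T | i != t) (if (i < t.+1)%N then round_prob p r w i else 4^-1) =
   \prod_(i < T | i != t) (if (i < t)%N then round_prob p r w i else 4^-1).
  by apply: eq_bigr => i it; rewrite ltnS leq_eqVlt val_eqE (negbTE it).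
move: (init_prob _ _) (round_prob _ _ _ _) (\prod_(i < T | _) _) => x y z.
by field.
Qed.

(** [F] and [partial_prob p r t] ignore the outcome of round [t], so averaging over its four toggles
    integrates the round out. *)
Lemma partial_prob_marginal p r t (F : trajectory T -> R) :
  (forall b y w, F (toggle t b y w) = F w) ->
  \sum_w partial_prob p r t.+1 w * F w = \sum_w partial_prob p r t w * F w.
Proof.
move=> F_toggle.
have avg (b y : bool) : \sum_w partial_prob p r t.+1 w * F w =
    \sum_w 4 * partial_prob p r t w * F w * round_prob p r (toggle t b y w) t.
  rewrite (reindex_inj (inv_inj (toggleK t b y))); apply: eq_bigr => w _.
  rewrite partial_probS partial_prob_toggle F_toggle; ring.
have : \sum_(b : bool) \sum_(y : bool) \sum_w partial_prob p r t.+1 w * F w =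
    \sum_w 4 * partial_prob p r t w * F w.
  rewrite pair_big /= (eq_bigr _ (fun by_ _ => avg by_.1 by_.2)) exchange_big.
  apply: eq_bigr => w _ /=; rewrite -mulr_sumr.
  rewrite -(pair_big xpredT xpredT (fun b y => round_prob p r (toggle t b y w) t)) /=.
  by rewrite sum_round_prob_toggle mulr1.
under [RHS]eq_bigr do rewrite -mulrA.
by rewrite -mulr_sumr !big_bool /=; lra.
Qed.

Lemma partial_prob_tail p r t (F : trajectory T -> R) (m : nat) :
  (forall (s : 'I_T) b y w, (t < s)%N -> F (toggle s b y w) = F w) ->
  (t < m <= T)%N ->
  \sum_w partial_prob p r m w * F w = \sum_w partial_prob p r t.+1 w * F w.
Proof.
move=> F_toggle; elim: m => // m IHm /andP[]; rewrite ltnS leq_eqVlt.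
case/predU1P => [-> //|tm mT].
rewrite (@partial_prob_marginal p r (Ordinal mT)) /= ?IHm ?tm ?(ltnW mT) //.
by move=> b y w; rewrite F_toggle.
Qed.

Lemma traj_partial_prob p r w : traj_prob p A r w = partial_prob p r T w.
Proof.
by congr (_ * _); apply: eq_bigr => t _; rewrite ltn_ord.
Qed.

Lemma traj_prob_marginal p r t (x : arm) :
  \sum_w traj_prob p A r w * (pulled w t == x)%:R =
  \sum_w partial_prob p r t.+1 w * (pulled w t == x)%:R.
Proof.
under eq_bigr do rewrite traj_partial_prob.
apply: (@partial_prob_tail p r t (fun w => (pulled w t == x)%:R)).
  by move=> s b y w ts; rewrite pulled_toggle.
by rewrite leqnn ltn_ord.
Qed.

Lemma traj_prob_total p r : 0 <= p -> \sum_w traj_prob p A r w = 1.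
Proof.
move=> p_ge0.
have step m : (m <= T)%N ->
    \sum_w partial_prob p r m w = \sum_w partial_prob p r 0 w.
  elim: m => // m IHm mT; rewrite -(IHm (ltnW mT)).
  have := @partial_prob_marginal p r (Ordinal mT) (fun=> 1) (fun _ _ _ => erefl).
  by under eq_bigr do rewrite mulr1; under [RHS]eq_bigr do rewrite mulr1.
under eq_bigr do rewrite traj_partial_prob.
rewrite step //.
have -> : \sum_w partial_prob p r 0 w =
    \sum_(w : trajectory T) init_prob p (w.1 ord0) * 4^-1 ^+ T.
  by apply: eq_bigr => w _; rewrite /partial_prob prodr_const card_ord.
(* Once all rounds are uniform, flipping the initial arm pairs the two placements, whose
   probabilities add up to 1. *)
pose f (w : trajectory T) : trajectory T :=
  ([ffun i => w.1 i (+) (i == ord0)], w.2).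
have fK : involutive f.
  by case=> x a; congr (_, _); apply/ffunP => i; rewrite !ffunE addbK.
set S := \sum_w _.
have p1 : 1 + p != 0 by rewrite gt_eqF // ltr_wpDr.
have : S + S = 2.
  rewrite {1}/S (reindex_inj (inv_inj fK)) /= /S -big_split /=.
  rewrite (eq_bigr (fun=> 4^-1 ^+ T)); last first.
    move=> w _; rewrite -mulrDl ffunE eqxx addbT /init_prob.
    by case: (w.1 ord0) => /=; rewrite -mulrDl ?[p + 1]addrC divff ?mul1r.
  rewrite sumr_const card_prod !card_ffun !card_ord card_bool.
  rewrite -[LHS]mulr_natl natrM !natrX exprS -!mulrA -!exprMn.
  have -> : 2 * (2 * 4^-1) = 1 :> R by lra.
  by rewrite expr1n mulr1.
lra.
Qed.

(** * Flipping the arms from the last switch on *)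

Definition flip (s : nat) w : trajectory T :=
  ([ffun i => w.1 i (+) (s <= i)%N], w.2).

Lemma flipK s : involutive (flip s).
Proof. by case=> x a; congr (_, _); apply/ffunP => i; rewrite !ffunE addbK. Qed.

Lemma action_prob_ge0 h a : 0 <= action_prob A h a.
Proof.
rewrite /action_prob; case: eqP => _; first exact: switch_prob_ge0.
by rewrite subr_ge0 switch_prob_le1.
Qed.

Lemma move_prob_ge0 x a y : 0 <= move_prob (1 / 2) x a y :> R.
Proof. by case: x; case: a; case: y; rewrite /move_prob /=; lra. Qed.

Lemma init_prob_half x :
  init_prob (1 / 2) x = (if x == ref_arm then 1 / 3 else 2 / 3) :> R.
Proof. by case: x; rewrite /init_prob /=; field. Qed.

Lemma init_prob_ge0 x : 0 <= init_prob (1 / 2) x :> R.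
Proof. by rewrite init_prob_half; case: eqP => _; lra. Qed.

Lemma round_prob_ge0 r w t : 0 <= round_prob (1 / 2) r w t.
Proof. by rewrite mulr_ge0 ?action_prob_ge0 ?move_prob_ge0. Qed.

Lemma partial_prob_ge0 r m w : 0 <= partial_prob (1 / 2) r m w.
Proof.
rewrite mulr_ge0 ?init_prob_ge0 // prodr_ge0 // => t _.
by case: ifP => _; rewrite ?round_prob_ge0 // invr_ge0 ler0n.
Qed.

(** The observations agree, so the action probabilities do too. A switch lands on the reference arm
    with probability at most 1/2 and on the decoy arm with at least 1/2; for [s = 0] the initial
    placement compares 1/3 with 2/3. *)
Lemma partial_prob_flip (r r' : rewards R T) (s : nat) t w :
  (s <= t.+1)%N ->
  (forall u : 'I_T, (s <= u <= t)%N -> w.2 u = stay) ->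
  (forall u : 'I_T, u.+1 = s -> w.2 u = switch) ->
  (forall (u : 'I_T) x, (u.+1 < s)%N -> r' u x = r u x) ->
  (forall u : 'I_T, (s <= u.+1)%N -> r' u decoy_arm = r u ref_arm) ->
  pulled w t = ref_arm ->
  partial_prob (1 / 2) r t.+1 w <= partial_prob (1 / 2) r' t.+1 (flip s w).
Proof.
move=> st stays switches r'_before r'_after wt.
(* Changing arm while staying has probability 0. *)
have [moved|] := boolP [exists u : 'I_T, [&& (s <= u)%N, (u <= t)%N &
                                        entered w u != pulled w u]].
  case/existsP: moved => u /and3P[su ut uu].
  suff -> : partial_prob (1 / 2) r t.+1 w = 0 by exact: partial_prob_ge0.
  rewrite /partial_prob (bigD1 u) //= ltnS ut /round_prob stays ?su //.
  by rewrite /move_prob /= eq_sym (negbTE uu) mulr0 mul0r mulr0.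
move=> /existsPn run.
have on_ref (i : 'I_T.+1) : (s <= i <= t.+1)%N -> w.1 i = ref_arm.
  case/andP => si it.
  have : (t.+1 - i)%N = (t.+1 - i)%N by [].
  move: {-2}(t.+1 - i)%N => d; elim: d i si it => [|d IHd] i si it e.
    rewrite -[RHS]wt; congr (w.1 _); apply/val_inj; rewrite /= /bump /=; lia.
  have iT : (i < T)%N by have := ltn_ord t; lia.
  have := run (Ordinal iT); rewrite /= si /=.
  have -> /= : (i <= t)%N by lia.
  rewrite negbK => /eqP ei.
  have -> : w.1 i = entered w (Ordinal iT) by congr (w.1 _); apply/val_inj.
  by rewrite ei /pulled IHd //= /bump /=; lia.
have obs (u : 'I_T) : (u <= t)%N -> r u (pulled w u) = r' u (pulled (flip s w) u).
  move=> ut; rewrite {2}/pulled ffunE lift0; case: leqP => su.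
    have -> : w.1 (lift ord0 u) = ref_arm by apply: on_ref; rewrite lift0 su.
    rewrite r'_after //; congr (r u _).
    by rewrite /pulled on_ref // lift0 su.
  by rewrite addbF r'_before.
apply: ler_pM; [exact: init_prob_ge0| | |].
- apply: prodr_ge0 => u _; case: ifP => _; first exact: round_prob_ge0.
  by rewrite invr_ge0 ler0n.
- rewrite ffunE; case: leqP => s0; last by rewrite addbF.
  by rewrite on_ref ?s0 // !init_prob_half /=; lra.
apply: ler_prod => u _; case: ltnP => ut; last by rewrite lexx invr_ge0 ler0n.
rewrite round_prob_ge0 /round_prob.
rewrite (@eq_history r r' w (flip s w)) //; last first.
  by move=> v vu; apply: obs; rewrite -ltnS (ltn_trans vu).
rewrite ler_wpM2l ?action_prob_ge0 //= /entered /pulled !ffunE lift0 /=.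
have [su|us] := leqP s u.
  rewrite leqW // stays ?su -1?ltnS // /move_prob /=.
  by do 2!case: (w.1 _).
(* Earlier rounds are unchanged; what remains is [u.+1 = s], the round of the last switch. *)
have [su|us'] := leqP s u.+1; last by rewrite !addbF.
rewrite switches; last lia.
rewrite (on_ref (lift ord0 u)) ?lift0 ?su //.
by case: (w.1 _); rewrite /move_prob /=; lra.
Qed.

(** [s] indexes the arm reached by the last switch up to round [t]; [s = 0] encodes that there was
    none, the last clause being then vacuous. *)
Lemma last_switch (a : {ffun 'I_T -> action}) t :
  exists s : nat, [/\ (s <= t.+1)%N,
    forall u : 'I_T, (s <= u <= t)%N -> a u = stay &
    forall u : 'I_T, u.+1 = s -> a u = switch].
Proof.
case: t => t tT /=; elim: t tT => [|t IHt] tT.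
  case E: (a (Ordinal tT)).
    exists 1%N; split=> // u; first lia.
    by case=> u0; rewrite -[RHS]E; congr (a _); apply/val_inj.
  exists 0%N; split=> // u /= u0.
  by rewrite -[RHS]E; congr (a _); apply/val_inj => /=; lia.
case E: (a (Ordinal tT)).
  exists t.+2; split=> // u; first lia.
  by case=> u0; rewrite -[RHS]E; congr (a _); apply/val_inj.
have [s [st stays switches]] := IHt (ltnW tT).
exists s; split=> //; first exact: leqW.
move=> u /andP[su]; rewrite leq_eqVlt => /predU1P[ut|ut].
  by rewrite -[RHS]E; congr (a _); apply/val_inj.
by rewrite stays // su.
Qed.

End Law.

Arguments partial_prob {R} A {T} p r m w.
Arguments flip {T} s w.

(** * Averaging the regret over the noise *)

Section LowerBound.
Variables (R : realType) (A : player R) (L T h : nat) (lam : R).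
Hypotheses (T_lt : (T < 2 ^ L)%N) (h_gt0 : (0 < h)%N).
Hypotheses (lam_gt0 : 0 < lam) (lam_le1 : lam <= 1) (lamL : 1 / 2 <= lam ^+ L).

Let Noise := noise L T h.*2.

(** The offset [h] centers at 0 the increasing side, which runs from [-h] to [h]. *)
Definition tent (x : 'I_(h.*2.*2).+1) : R :=
  (cyc_norm (x + inord h))%:R / (h.*2)%:R.

Definition noisy_rewards (xi : Noise) : rewards R T :=
  fun t x => tent (walk xi t + inord 1 *+ (x == ref_arm)).

Lemma tent_bounds x : 0 <= tent x <= 1.
Proof.
rewrite /tent divr_ge0 ?ler0n //= ler_pdivrMr ?ltr0n ?double_gt0 //.
by rewrite mul1r ler_nat cyc_norm_le.
Qed.

(** Within distance [h] of 0 the increment is exactly the slope; beyond it the increment is at least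
    minus the slope, and the subtracted term is at least 2. *)
Lemma tent_slope x :
  (1 - 2 / h%:R ^+ 2 * (cyc_norm x)%:R ^+ 2) / (h.*2)%:R <=
  tent (x + inord 1) - tent x.
Proof.
have h2_gt0 : 0 < (h.*2)%:R :> R by rewrite ltr0n double_gt0.
have h_gt0' : 0 < h%:R ^+ 2 :> R by rewrite exprn_gt0 // ltr0n.
rewrite /tent -mulrBl ler_pM2r ?invr_gt0 //.
have [small|large] := ltnP (cyc_norm x) h.
  rewrite cyc_norm_ramp // -[X in _ <= X - _]natr1 addrAC subrr add0r gerBl.
  by rewrite mulr_ge0 ?divr_ge0 ?sqr_ge0 // ltW.
have : (cyc_norm (x + inord h)%R <= (cyc_norm (x + inord 1 + inord h)%R).+1)%N.
  rewrite addrAC; apply: (cyc_norm_succ _ _ _).2; lia.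
rewrite -(ler_nat R) -[X in _ <= X]natr1.
have : 2 <= 2 / h%:R ^+ 2 * (cyc_norm x)%:R ^+ 2 :> R.
  rewrite mulrAC ler_pdivlMr // ler_pM2l // ler_pXn2r ?nnegrE ?ler0n //.
  by rewrite ler_nat.
lra.
Qed.

Definition arm_prob (xi : Noise) (t : 'I_T) (x : arm) : R :=
  \sum_w traj_prob (1 / 2) A (noisy_rewards xi) w * (pulled w t == x)%:R.

Lemma noisy_rewards_shift s xi (u : 'I_T) x : (0 < s)%N ->
  noisy_rewards (shift s xi) u x =
  tent (walk xi u + inord 1 *+ ((s <= u.+1) + (x == ref_arm))).
Proof. by move=> s0; rewrite /noisy_rewards walk_shift // -addrA -mulrnDr. Qed.

(* A player on the reference arm since his last switch could equally well have
   stayed on the decoy arm: shifting the noise by one from that switch on restores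
   his observations, and costs at most a factor 2 in probability. *)
Lemma ref_le_decoy t :
  \sum_xi weight lam xi * arm_prob xi t ref_arm <=
  2 * \sum_xi weight lam xi * arm_prob xi t decoy_arm.
Proof.
have split_actions x :
    \sum_xi weight lam xi * arm_prob xi t x =
    \sum_(a : {ffun 'I_T -> action}) \sum_xi \sum_(y : {ffun 'I_T.+1 -> arm})
      weight lam xi * (partial_prob A (1 / 2) (noisy_rewards xi) t.+1 (y, a) *
      (pulled (y, a) t == x)%:R).
  rewrite exchange_big; apply: eq_bigr => xi _ /=.
  rewrite /arm_prob traj_prob_marginal mulr_sumr exchange_big /=.
  by rewrite pair_bigA /=; apply: eq_bigr => -[y a].
rewrite !split_actions mulr_sumr; apply: ler_sum => a _.
(* For fixed actions [s] is constant, so the shift and the flip reindex the sums over noises and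
   arms. *)
have [s [st stays switches]] := @last_switch T a t.
(* Shifts need a positive start; 0 and 1 select the same rounds, as only the initial arm has index
   0. *)
pose s' := maxn s 1.
pose flip_arms (y : {ffun 'I_T.+1 -> arm}) := (flip s (y, a)).1.
have flip_armsK : involutive flip_arms.
  by move=> y; apply/ffunP => i; rewrite !ffunE addbK.
rewrite [in X in _ <= X](reindex_inj (@shift_inj L T h.*2 s')) /= mulr_sumr.
apply: ler_sum => xi _; rewrite mulr_sumr.
rewrite [in X in _ <= X](reindex_inj (inv_inj flip_armsK)).
apply: ler_sum => y _.
have s'_gt0 : (0 < s')%N by rewrite /s'; lia.
have shift_heavy : weight lam xi <= 2 * weight lam (shift s' xi).
  have := @weight_shift R lam lam_gt0 lam_le1 L T h.*2 s' xi.
  rewrite double_gt0 => /(_ h_gt0).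
  have := weight_gt0 R lam lam_gt0 L T h.*2 xi.
  move: lamL; nra.
have [y_ref|] := eqVneq (pulled (y, a) t) ref_arm; last first.
  move=> _; rewrite !mulr0 mulr_ge0 // mulr_ge0 //.
    exact/ltW/weight_gt0.
  by rewrite mulr_ge0 // partial_prob_ge0.
have -> : pulled (flip_arms y, a) t = decoy_arm.
  by rewrite /pulled /= ffunE lift0 st addbT -[decoy_arm]/(~~ ref_arm) -y_ref.
rewrite eqxx !mulr1 mulrA ler_pM ?partial_prob_ge0 ?(ltW (weight_gt0 _ _ _ _ _ _ _)) //.
have -> : (flip_arms y, a) = flip s (y, a) by [].
apply: partial_prob_flip => // u.
  move=> x us; rewrite noisy_rewards_shift //.
  by have -> : (s' <= u.+1)%N = false by rewrite /s'; lia.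
move=> su; rewrite noisy_rewards_shift // /noisy_rewards.
by have -> : (s' <= u.+1)%N by rewrite /s'; lia.
Qed.

Lemma arm_prob_total xi t : arm_prob xi t ref_arm + arm_prob xi t decoy_arm = 1.
Proof.
rewrite -[RHS](@traj_prob_total R A T (1 / 2) (noisy_rewards xi)); last lra.
rewrite /arm_prob -big_split /=; apply: eq_bigr => w _.
by rewrite -mulrDr; case: (pulled w t); rewrite /= ?add0r ?addr0 mulr1.
Qed.

Lemma arm_prob_ge0 xi t x : 0 <= arm_prob xi t x.
Proof.
apply: sumr_ge0 => w _; rewrite traj_partial_prob mulr_ge0 ?ler0n //.
exact: partial_prob_ge0.
Qed.

Lemma regret_arm_prob xi :
  regret (1 / 2) A (noisy_rewards xi) =
  \sum_t (tent (walk xi t + inord 1) - tent (walk xi t)) *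
         arm_prob xi t decoy_arm.
Proof.
rewrite /regret /expected_reward.
under [X in _ - X]eq_bigr do rewrite mulr_sumr.
rewrite exchange_big -sumrB; apply: eq_bigr => t _.
rewrite -[noisy_rewards xi t ref_arm]mulr1.
rewrite -[X in _ * X - _](@traj_prob_total R A T (1 / 2) (noisy_rewards xi)); last lra.
rewrite mulr_sumr -sumrB /arm_prob mulr_sumr; apply: eq_bigr => w _.
rewrite /noisy_rewards /=; case: (pulled w t) => /=;
  rewrite ?mulr1n ?mulr0n ?addr0; ring.
Qed.

(** Per round, the decoy arm has averaged mass at least [M / 3] and the second moment costs at most
    [M / 6]; the remaining [M / 6] times the slope [1 / (2h)] gives [M / (12h)]. *)
Lemma exists_regret : 0 < 1 - lam ->
  192 * L%:R <= (1 - lam) ^+ 2 * 4 * h%:R ^+ 2 ->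
  exists xi : Noise, T%:R / (12 * h%:R) <= regret (1 / 2) A (noisy_rewards xi).
Proof.
move=> lam_lt1 h_large.
have h0 : 0 < h%:R :> R by rewrite ltr0n.
have w_gt0 (xi : Noise) : 0 < weight lam xi by exact: weight_gt0.
set M := \sum_(xi : Noise) weight lam xi.
have M_ge0 : 0 <= M by apply: sumr_ge0 => xi _; exact: ltW.
have decoy t : M / 3 <= \sum_(xi : Noise) weight lam xi * arm_prob xi t decoy_arm.
  have : \sum_(xi : Noise) weight lam xi * arm_prob xi t ref_arm +
      \sum_(xi : Noise) weight lam xi * arm_prob xi t decoy_arm = M.
    rewrite -big_split; apply: eq_bigr => xi _ /=.
    by rewrite -mulrDr arm_prob_total mulr1.
  by have := ref_le_decoy t; lra.
have far t : 2 / h%:R ^+ 2 * (\sum_(xi : Noise) weight lam xi *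
     (cyc_norm (walk xi t))%:R ^+ 2) <= M / 6.
  have := @walk_second_moment R lam lam_gt0 lam_le1 L T h.*2 t.
  rewrite -/M; set S := \sum_xi _ => S_le.
  rewrite mulrAC ler_pdivrMr ?exprn_gt0 //.
  rewrite -(ler_pM2l (exprn_gt0 2 lam_lt1)).
  have := ler_wpM2r M_ge0 h_large; move: S_le.
  set q := (1 - lam) ^+ 2; set H := h%:R ^+ 2 => S_le.
  have -> : q * 4 * H * M = 24 * (q * (M / 6 * H)) by field.
  have -> : q * (2 * S) = 2 * (q * S) by ring.
  lra.
have total : M * (T%:R / (12 * h%:R)) <=
    \sum_(xi : Noise) weight lam xi * regret (1 / 2) A (noisy_rewards xi).
  under eq_bigr do rewrite regret_arm_prob mulr_sumr.
  rewrite exchange_big /=.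
  have -> : M * (T%:R / (12 * h%:R)) = \sum_(t < T) M / (12 * h%:R).
    by rewrite sumr_const card_ord -mulr_natl; field; rewrite gt_eqF.
  apply: ler_sum => t _.
  (* The slope bound times the decoy probability, with the loss term kept whole since that
     probability is at most 1. *)
  pose lower (xi : Noise) : R := (weight lam xi * arm_prob xi t decoy_arm -
     2 / h%:R ^+ 2 * (weight lam xi * (cyc_norm (walk xi t))%:R ^+ 2)) / (h.*2)%:R.
  apply: (@le_trans _ _ (\sum_xi lower xi)).
    rewrite -mulr_suml sumrB -mulr_sumr.
    have h2E : (h.*2)%:R = h%:R * 2 :> R by rewrite -muln2 natrM.
    rewrite [X in _ <= _ / X]h2E ler_pdivlMr ?mulr_gt0 //.
    have -> : M / (12 * h%:R) * (h%:R * 2) = M / 6 by field; rewrite gt_eqF.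
    have := decoy t; have := far t; lra.
  apply: ler_sum => xi _.
  rewrite ler_pdivrMr ?ltr0n ?double_gt0 //.
  have := tent_slope (walk xi t); rewrite ler_pdivrMr ?ltr0n ?double_gt0 //.
  have p_ge0 := arm_prob_ge0 xi t decoy_arm.
  have p_le1 : arm_prob xi t decoy_arm <= 1.
    by rewrite -(arm_prob_total xi t) lerDr arm_prob_ge0.
  set d := tent _ - tent _; set pr := arm_prob _ _ _ in p_ge0 p_le1 *.
  set z := 2 / _ * _ => slope.
  have z_ge0 : 0 <= z by rewrite mulr_ge0 ?divr_ge0 ?sqr_ge0.
  have -> : 2 / h%:R ^+ 2 * (weight lam xi * (cyc_norm (walk xi t))%:R ^+ 2) =
      weight lam xi * z by rewrite mulrCA.
  have -> : weight lam xi * (d * pr) * h.*2%:R = weight lam xi * (pr * (d * h.*2%:R)).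
    by ring.
  rewrite -mulrBr ler_pM2l //; apply: le_trans (ler_wpM2l p_ge0 slope).
  have := mulr_ge0 z_ge0 (_ : 0 <= 1 - pr); rewrite subr_ge0 => /(_ p_le1); lra.
have [/existsP[xi ok]|] := boolP [exists xi : Noise,
    T%:R / (12 * h%:R) <= regret (1 / 2) A (noisy_rewards xi)].
  by exists xi.
(* If every regret were smaller, so would be the weighted average; strictness needs one noise, the
   zero one. *)
move/existsPn => small; exfalso; move: total; rewrite leNgt => /negP; apply.
rewrite /M mulr_suml; apply: ltr_sum => [|xi _].
  by apply/hasP; exists [ffun=> ord0]; rewrite ?mem_index_enum.
by rewrite ltr_pM2l // ltNge small.
Qed.

End LowerBound.

(** * Choice of the parameters *)

Lemma exists_sqrt_bounds L : (0 < L)%N ->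
  exists s : nat, [/\ (0 < s)%N, (L <= s ^ 2)%N & (s ^ 2 <= 4 * L)%N].
Proof.
move=> L_gt0.
have ex : exists s, (L <= s ^ 2)%N by exists L; rewrite leq_pmull.
case: (ex_minnP ex) => s Ls s_min; exists s; split=> //.
  by case: s Ls {s_min} => // ; rewrite leqNgt L_gt0.
case: s Ls s_min => [|[|s]] Ls s_min; [by []|lia|].
(* By minimality of [s.+2]; then [s.+2 <= 2 * s.+1] gives the bound. *)
have : (s.+1 ^ 2 < L)%N by rewrite ltnNge; apply/negP => /s_min; rewrite ltnn.
nia.
Qed.

Theorem theorem6 (R : realType) :
  exists (c : R) (T0 : nat), 0 < c /\ (0 < T0)%N /\
    forall T : nat, (T0 <= T)%N ->
    forall A : player R,
    exists r : rewards R T,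
      (forall (t : 'I_T) (x : arm), 0 <= r t x <= 1) /\
      c * T%:R / (ln (T%:R : R)) `^ (3 / 2) <= regret (1 / 2) A r.
Proof.
have ln2_gt0 : 0 < ln 2 :> R by rewrite ln_gt0 // ltr1n.
(* [L <= 2 * trunc_log 2 T] yields [2 / ln 2]; adding 1 makes [K >= 1], so that later
   [K ^+ 3 <= K ^+ 4]. *)
pose K : R := 1 + 2 / ln 2.
have K_ge1 : 1 <= K by rewrite lerDl divr_ge0 // ltW.
have K_gt0 : 0 < K by exact: lt_le_trans K_ge1.
(* 168 is 12 from the averaged regret times 14 from [h]; [2 * K ^+ 2] bounds [L * s] against the
   power of the logarithm. *)
exists (168 * (2 * K ^+ 2))^-1, 2%N; split.
  by rewrite invr_gt0 !mulr_gt0.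
split=> // T T_ge2 A.
set L := (trunc_log 2 T).+1.
have T_lt : (T < 2 ^ L)%N by exact: trunc_log_ltn.
have L_gt0 : (0 < L)%N by [].
have lnT_gt0 : 0 < ln T%:R :> R by rewrite ln_gt0 // ltr1n.
have L_le : L%:R <= K * ln T%:R :> R.
  have log_gt0 : (0 < trunc_log 2 T)%N by rewrite trunc_log_gt0.
  have : (trunc_log 2 T)%:R * ln 2 <= ln T%:R :> R.
    rewrite mulr_natl -lnXn // ler_ln ?posrE ?exprn_gt0 ?ltr0n //; last lia.
    by rewrite -natrX ler_nat trunc_logP //; lia.
  have : L%:R <= 2 * (trunc_log 2 T)%:R :> R by rewrite -natrM ler_nat /L; lia.
  have -> : K * ln T%:R = ln T%:R + 2 * (ln T%:R / ln 2).
    by rewrite /K; field; rewrite gt_eqF.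
  rewrite -ler_pdivlMr // => h1 h2; lra.
have [s [s_gt0 Ls sL]] := exists_sqrt_bounds L L_gt0.
(* [s] stands for the square root of [L]. With [1 - lam = 1 / (2L)] the size condition on [h]
   becomes [192 L <= 196 s ^ 2]. *)
pose h := (14 * L * s)%N.
have h_gt0 : (0 < h)%N by rewrite /h !muln_gt0 s_gt0.
have Lr : 0 < L%:R :> R by rewrite ltr0n.
have L_ge1 : 1 <= L%:R :> R by rewrite ler1n.
pose lam : R := 1 - (2 * L%:R)^-1.
have inv_gt0 : 0 < (2 * L%:R)^-1 :> R by rewrite invr_gt0 mulr_gt0.
have inv_le : (2 * L%:R)^-1 <= 1 / 2 :> R.
  rewrite -div1r ler_pdivrMr ?mulr_gt0 //; lra.
have lam_gt0 : 0 < lam by rewrite /lam; lra.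
have lam_le1 : lam <= 1 by rewrite /lam; lra.
have lamL : 1 / 2 <= lam ^+ L.
  have bernoulli (m : nat) : 1 - m%:R * (2 * L%:R)^-1 <= lam ^+ m.
    elim: m => [|m IHm]; first by rewrite expr0; lra.
    rewrite exprS -[m.+1%:R]natr1; apply: le_trans (ler_wpM2l (ltW lam_gt0) IHm).
    rewrite -subr_ge0 /lam.
    set x := (2 * L%:R)^-1.
    have -> : (1 - x) * (1 - m%:R * x) - (1 - (m%:R + 1) * x) = m%:R * x ^+ 2.
      by ring.
    by rewrite mulr_ge0 ?sqr_ge0.
  apply: le_trans (bernoulli L).
  have -> : L%:R * (2 * L%:R)^-1 = 1 / 2 :> R by field; rewrite gt_eqF.
  lra.
have [||xi xi_regret] :=
    @exists_regret R A L T h lam T_lt h_gt0 lam_gt0 lam_le1 lamL.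
- by rewrite /lam; lra.
- have -> : (1 - lam) ^+ 2 * 4 * h%:R ^+ 2 = 196 * s%:R ^+ 2 :> R.
    by rewrite /lam /h !natrM; field; rewrite gt_eqF.
  have : L%:R <= s%:R ^+ 2 :> R by rewrite -natrX ler_nat.
  lra.
exists (noisy_rewards R L T h xi); split; first by move=> t x; exact: tent_bounds.
apply: le_trans xi_regret.
set P := _ `^ _.
have P_gt0 : 0 < P by exact: powR_gt0.
have P2 : P ^+ 2 = ln T%:R ^+ 3.
  rewrite -powR_mulrn ?(ltW P_gt0) // -powRrM -powR_mulrn ?(ltW lnT_gt0) //.
  by congr (_ `^ _); field.
(* Compared after squaring, through [s ^ 2 <= 4 L] and [L <= K * ln T]. *)
have Ls_le : L%:R * s%:R <= 2 * K ^+ 2 * P :> R.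
  rewrite -(@ler_pXn2r _ 2) ?nnegrE ?mulr_ge0 ?(ltW P_gt0) ?(ltW K_gt0) //.
  rewrite [(L%:R * _) ^+ 2]exprMn [(_ * P) ^+ 2]exprMn P2.
  have s_le : s%:R ^+ 2 <= 4 * L%:R :> R by rewrite -natrX -natrM ler_nat.
  apply: (@le_trans _ _ (4 * L%:R ^+ 3)).
    have -> : 4 * L%:R ^+ 3 = L%:R ^+ 2 * (4 * L%:R) :> R by ring.
    by rewrite ler_wpM2l ?sqr_ge0.
  apply: (@le_trans _ _ (4 * (K * ln T%:R) ^+ 3)).
    rewrite ler_pM2l // ler_pXn2r ?nnegrE ?(ltW Lr) //.
    exact: le_trans (ltW Lr) L_le.
  rewrite exprMn mulrA ler_pM2r ?exprn_gt0 //.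
  have -> : (2 * K ^+ 2) ^+ 2 = 4 * K ^+ 4 :> R by ring.
  by rewrite ler_pM2l // ler_weXn2l.
have sr : 0 < s%:R :> R by rewrite ltr0n.
have -> : (168 * (2 * K ^+ 2))^-1 * T%:R / P = T%:R / (168 * (2 * K ^+ 2 * P)).
  by field; rewrite !gt_eqF.
rewrite ler_wpM2l // lef_pV2 ?posrE ?mulr_gt0 ?exprn_gt0 ?ltr0n //.
rewrite /h !natrM; lra.
Qed.
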